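(* Let $\Phi$ be a Young function, let $u:\Omega\to\mathbb{C}$ be $\Sigma$-measurable, and let $T=EM_u$, $T(f)=E(uf)$, be bounded on $L^{\Phi}(\Sigma)$. If $\mathcal{A}\ne\Sigma$, then $$\sigma(T)=\operatorname{ess\,range}(E(u))\cup\{0\},$$ where $\sigma(T)$ is the spectrum of $T$ as an operator on $L^\Phi(\Sigma)$.
   Context: $(\Omega,\Sigma,\mu)$ is a measure space and $\mathcal{A}\subseteq\Sigma$ is a sub-$\sigma$-algebra with $(\Omega,\mathcal{A},\mu|_{\mathcal{A}})$ $\sigma$-finite; in particular it has the finite subset property (every $A\in\mathcal{A}$ with $\mu(A)>0$ contains some $B\in\mathcal{A}$ with $0<\mu(B)<\infty$). $E=E^{\mathcal{A}}$ is the conditional expectation with respect to $\mathcal{A}$: $E(f)$ is the a.e. unique $\mathcal{A}$-measurable function with $\int_A f\,d\mu=\int_A E(f)\,d\mu$ for all $A\in\mathcal{A}$, defined for nonnegative $f$ (with values in $[0,\infty]$) and extended to complex $f$ with $E(|f|)<\infty$ a.e. A Young function is a continuous convex $\Phi:\mathbb{R}\to[0,\infty)$ with $\Phi(x)=0$ iff $x=0$, $\Phi(-x)=\Phi(x)$, and $\lim_{x\to\infty}\Phi(x)/x=\infty$. $L^\Phi(\Sigma)$ is the Orlicz space of $\Sigma$-measurable $f:\Omega\to\mathbb{C}$ with $\int_\Omega\Phi(k|f|)\,d\mu<\infty$ for some $k>0$, with norm $N_\Phi(f)=\inf\{k>0:\int_\Omega\Phi(|f|/k)\,d\mu\le 1\}$.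 ''$T$ bounded on $L^\Phi(\Sigma)$'' means $E(uf)$ is defined for all $f\in L^\Phi(\Sigma)$ and $T$ maps $L^\Phi(\Sigma)$ boundedly into itself. The essential range of $h$ is the set of $\lambda\in\mathbb{C}$ such that $\mu(\{x:|h(x)-\lambda|<\varepsilon\})>0$ for all $\varepsilon>0$.
   Formalization: The condition that A differs from Σ is taken modulo null sets: some set in Σ agrees a.e. with no member of A. Under literal inequality the claim fails, e.g. for A = Borel, Σ = Lebesgue sets of [0,1] and u = 1, where T = I. *)

(* Defs.v *)
From HB Require Import structures.
From mathcomp Require Import all_boot all_order all_algebra.
From mathcomp Require Import complex.
From mathcomp Require Import all_classical all_reals all_analysis.
From mathcomp Require Import measurable_realfun.

Set Implicit Arguments.
Unset Strict Implicit.
Unset Printing Implicit Defensive.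
Import Order.TTheory GRing.Theory Num.Theory.
Import numFieldNormedType.Exports.

Local Open Scope classical_set_scope.
Local Open Scope ring_scope.
Local Open Scope complex_scope.

(* |z| as an element of R; MathComp's `|z| lives in R[i]. *)
Definition cmod (R : realType) (z : R[i]) : R := complex.Re `|z|.

Definition complex_measurable d (T : measurableType d) (R : realType)
    (f : T -> R[i]) : Prop :=
  measurable_fun setT (fun x => complex.Re (f x)) /\
  measurable_fun setT (fun x => complex.Im (f x)).

Record young_function (R : realType) (Phi : R -> R) : Prop := YoungFunction {
  young_ge0 : forall x, 0 <= Phi x;
  young_continuous : continuous Phi;
  young_convex : convex_function [set: R^o] Phi;
  young_eq0 : forall x, Phi x = 0 <-> x = 0;
  young_even : forall x, Phi (- x) = Phi x;
  young_superlinear : (Phi x / x) @[x --> +oo] --> +oo }.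

Section Orlicz.
Context d (T : measurableType d) (R : realType).
Variables (mu : {measure set T -> \bar R}) (Phi : R -> R).

Definition orlicz_modular (k : R) (f : T -> R[i]) : \bar R :=
  (\int[mu]_x (Phi (k * cmod (f x))%R)%:E)%E.

Definition orlicz (f : T -> R[i]) : Prop :=
  complex_measurable f /\ exists2 k : R, 0 < k & (orlicz_modular k f < +oo)%E.

Definition luxemburg_norm (f : T -> R[i]) : R :=
  inf [set k : R | 0 < k /\ (orlicz_modular k^-1 f <= 1)%E].

Definition orlicz_bounded (S : (T -> R[i]) -> T -> R[i]) : Prop :=
  (forall f, orlicz f -> orlicz (S f)) /\
  exists M : R, forall f, orlicz f ->
    luxemburg_norm (S f) <= M * luxemburg_norm f.

(* The elements of the Orlicz space are classes of functions modulo a.e.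
   equality; an operator on it is represented by a map on functions that is
   compatible with a.e. equality and linear up to a.e. equality. *)
Definition orlicz_linear (S : (T -> R[i]) -> T -> R[i]) : Prop :=
  (forall f g, orlicz f -> orlicz g -> ae_eq mu setT f g ->
    ae_eq mu setT (S f) (S g)) /\
  (forall (a : R[i]) f g, orlicz f -> orlicz g ->
    ae_eq mu setT (S (fun x => a * f x + g x)) (fun x => a * S f x + S g x)).

(* Complement of the set of l for which S - l I has a bounded linear
   two-sided inverse V. *)
Definition orlicz_spectrum (S : (T -> R[i]) -> T -> R[i]) : set R[i] :=
  [set l | ~ exists V : (T -> R[i]) -> T -> R[i],
    [/\ orlicz_linear V, orlicz_bounded V &
      forall f, orlicz f ->
        ae_eq mu setT (V (fun x => S f x - l * f x)) f /\
        ae_eq mu setT (fun x => S (V f) x - l * V f x) f]].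

End Orlicz.

Section CondExp.
Context d (T : measurableType d) (R : realType).
Variables (mu : {measure set T -> \bar R}) (A : set (set T)).

Definition sub_sigma_algebra_of : Prop :=
  sigma_algebra setT A /\ A `<=` measurable.

Definition sub_sigma_finite : Prop :=
  exists2 F : (set T)^nat, \bigcup_i F i = setT &
    forall i, A (F i) /\ (mu (F i) < +oo)%E.

(* Sigma-algebras are compared modulo null sets: some measurable set agrees
   a.e. with no member of A.  Under bare inequality of set systems, A and
   Sigma could still have the same classes of functions (Borel and Lebesgue
   sets, say), making conditional expectation the identity.  For A containing
   all null sets this is equivalent to A <> measurable. *)
Definition proper_mod_null : Prop :=
  exists2 S : set T, measurable S & forall B, A B -> mu (S `+` B) != 0%E.

Definition is_condexp_ge0 (f g : T -> \bar R) : Prop :=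
  [/\ forall x, (0 <= g x)%E,
      forall B : set (\bar R), measurable B -> A (g @^-1` B) &
      forall B, A B -> (\int[mu]_(x in B) f x = \int[mu]_(x in B) g x)%E].

(* A version of E(f) for measurable f >= 0; the a.e. class does not depend on
   the choice when A is sigma-finite. *)
Definition condexp_ge0 (f : T -> \bar R) : T -> \bar R :=
  xget (cst 0%E) [set g | is_condexp_ge0 f g].

Definition condexp_defined (f : T -> R[i]) : Prop :=
  {ae mu, forall x, (condexp_ge0 (fun y => (cmod (f y))%:E) x < +oo)%E}.

Definition condexp_real (h : T -> R) (x : T) : R :=
  fine (condexp_ge0 (EFin \o h^\+) x) - fine (condexp_ge0 (EFin \o h^\-) x).

Definition condexp (f : T -> R[i]) (x : T) : R[i] :=
  condexp_real (fun y => complex.Re (f y)) x +i*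
  condexp_real (fun y => complex.Im (f y)) x.

Definition condexp_mul (u f : T -> R[i]) : T -> R[i] :=
  condexp (fun x => u x * f x).

Definition condexp_mul_bounded (Phi : R -> R) (u : T -> R[i]) : Prop :=
  (forall f, orlicz mu Phi f -> condexp_defined (fun x => u x * f x)) /\
  orlicz_bounded mu Phi (condexp_mul u).

Definition ess_range (h : T -> R[i]) : set R[i] :=
  [set l | forall e : R, 0 < e -> (0 < mu [set x | (cmod (h x - l) < e)%R])%E].

End CondExp.

(* Main.v *)
Require Import Defs.
From HB Require Import structures.
From mathcomp Require Import all_boot all_order all_algebra.
From mathcomp Require Import complex.
From mathcomp Require Import all_classical all_reals all_analysis.
From mathcomp Require Import measurable_realfun.
From mathcomp Require Import ring lra.

(** The operator [T f = E(u f)] takes its values among the functions measurable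
    for the sub-sigma-algebra [A], and [E] commutes with multiplication by such
    functions: [E(w f) = w E(f)] a.e. for [w] measurable for [A] ([condexpM]).
    The three parts of the proof all come from these two facts.

    The point [0] is in the spectrum: an inverse of [T] would make every
    function of the Orlicz space a.e. equal to one measurable for [A]; but, by
    sigma-finiteness, the set that no member of [A] approximates can be taken of
    finite measure, and then its indicator is in the space
    ([zero_in_spectrum]).

    The essential range of [E(u)] is in the spectrum: if [l] belongs to it, then
    for every [e > 0] there is [B] in [A] with [0 < mu B < oo] on which
    [|E(u) - l| < e].  Then [(T - l) 1_B = (E(u) - l) 1_B] has norm at most
    [e N(1_B)], so a bounded inverse of [T - l] cannot exist
    ([ess_range_spectrum]).

    Every other [l] is in the resolvent set: multiplying [(T - l) g = f] by [u]
    and applying [E] gives [(E(u) - l) T g = T f], whence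
    [g = (T f / (E(u) - l) - f) / l], and this formula defines a bounded
    operator because [|E(u) - l|] is bounded below a.e. ([resolvent_exists]).

    What precedes needs the conditional expectation itself.  Existence for a
    nonnegative function that need not be integrable is obtained by cutting the
    function into countably many integrable pieces, applying the Radon-Nikodym
    theorem to each, and summing ([condexp_ge0_exists]); a.e. uniqueness is
    [sub_ae_eq].  Additivity and the pull-out formula then follow from
    uniqueness for nonnegative functions, and extend to real and complex
    functions by decomposing them.  On the side of the Orlicz norm only
    domination and the triangle inequality are used ([orlicz_le], [orliczD]). *)

Set Implicit Arguments.
Unset Strict Implicit.
Unset Printing Implicit Defensive.

Import Order.TTheory GRing.Theory Num.Theory.
Import numFieldNormedType.Exports.

Local Open Scope classical_set_scope.
Local Open Scope ring_scope.
Local Open Scope complex_scope.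

(** * Measure-theoretic preliminaries *)

Lemma aeI d (T : measurableType d) (R : realType)
    (mu : {measure set T -> \bar R}) (P Q : T -> Prop) :
  {ae mu, forall x, P x} -> {ae mu, forall x, Q x} ->
  {ae mu, forall x, P x /\ Q x}.
Proof. by apply: filterS2 => x. Qed.

(** Sigma-finiteness and finiteness are hypotheses rather than parts of the types
    of the measures, because for the restricted measure they follow from
    hypotheses on the sub-sigma-algebra. *)
Lemma radon_nikodym_measure d (T : measurableType d) (R : realType)
    (mu nu : {measure set T -> \bar R}) :
  sigma_finite setT mu -> fin_num_fun nu -> nu `<< mu ->
  exists f : T -> \bar R, [/\ forall x, (0 <= f x)%E, measurable_fun setT f &
    forall B, measurable B -> (nu B = \int[mu]_(x in B) f x)%E].
Proof.
move=> mufin nufin numu.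
pose smu := isSFinite.Build _ _ _ _ (sfinite_measure_sigma_finite mufin).
pose fmu := isSigmaFinite.Build _ _ _ _ mufin.
pose m := HB.pack_for (SigmaFiniteMeasure.type T R) (Measure.sort mu) smu fmu.
have nusfin : sigma_finite setT nu.
  by apply: fin_num_fun_sigma_finite => //; rewrite measure0.
pose snu := isSFinite.Build _ _ _ _ (sfinite_measure_sigma_finite nusfin).
pose fnu := isSigmaFinite.Build _ _ _ _ nusfin.
pose ffnu := isFinite.Build _ _ _ _ nufin.
pose n := HB.pack_for (FiniteMeasure.type T R) (Measure.sort nu) snu fnu ffnu.
have [f [f0 _ intf fE]] := @radon_nikodym_sigma_finite _ _ _ m n numu.
exists f; split=> //; exact: measurable_int intf.
Qed.

(** * The restriction of the measure to the sub-sigma-algebra *)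

Section Restriction.
Local Open Scope ereal_scope.
Context {d : measure_display} {T : measurableType d} {R : realType}.
Variables (mu : {measure set T -> \bar R}) (A : set (set T)).
Hypothesis hA : sub_sigma_algebra_of A.
(** A second measurable type with the carrier of [T] and the members of [A] as
    measurable sets: measurability for [A] becomes ordinary measurability on
    [TA], with its closure properties. *)
Local Notation TA := (g_sigma_algebraType A).

Lemma sub_measurableE (B : set T) : measurable (B : set TA) <-> A B.
Proof.
have [sA _] := hA.
by have := measurable_g_measurableTypeE sA => ->.
Qed.

Lemma sub_measurable (B : set T) : measurable (B : set TA) -> measurable B.
Proof. by move=> /sub_measurableE; exact: hA.2. Qed.

Lemma sub_measurable_fun d' (U : measurableType d') (f : T -> U) :
  measurable_fun (setT : set TA) f -> measurable_fun setT f.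
Proof. by move=> mf _ B mB; apply: sub_measurable; exact: (mf measurableT). Qed.

Lemma measurable_id_sub : measurable_fun (setT : set T) (id : T -> TA).
Proof. by move=> _ B mB; rewrite setTI; exact: sub_measurable. Qed.

Let restr : set TA -> \bar R := pushforward mu (id : T -> TA).

Let restr0 : restr set0 = 0.
Proof. by rewrite /restr /pushforward preimage_set0 measure0. Qed.

Let restr_ge0 B : 0 <= restr B. Proof. exact: (measure_ge0 mu). Qed.

Let restr_additive : semi_sigma_additive restr.
Proof.
move=> F mF tF mUF; apply: (@measure_semi_sigma_additive _ _ _ mu) => //.
- by move=> n; exact: sub_measurable (mF n).
- exact: sub_measurable mUF.
Qed.

Definition restr_measure : {measure set TA -> \bar R} :=
  HB.pack restr (isMeasure.Build _ _ _ restr restr0 restr_ge0 restr_additive).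

Lemma ge0_integral_restr (B : set T) (g : T -> \bar R) :
  measurable (B : set TA) -> measurable_fun (setT : set TA) g ->
  (forall x, 0 <= g x) ->
  \int[restr_measure]_(x in B) g x = \int[mu]_(x in B) g x.
Proof.
move=> mB mg g0.
rewrite (ge0_integral_pushforward measurable_id_sub)//.
exact: measurable_funTS.
Qed.

Hypothesis hfin : sub_sigma_finite mu A.

Lemma restr_sigma_finite :
  sigma_finite (setT : set TA) restr_measure.
Proof.
have [F FT AF] := hfin; exists F; first by rewrite FT.
by move=> i; have [? ?] := AF i; split => //; exact/sub_measurableE.
Qed.

(** The conditional expectation of an integrable function is the density, with
    respect to the restricted measure, of the finite measure that integrates the
    function over the members of [A]. *)
Lemma sub_radon_nikodym (f : T -> \bar R) :
  (forall x, 0 <= f x) -> mu.-integrable setT f ->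
  exists g : T -> \bar R, [/\ forall x, 0 <= g x,
    measurable_fun (setT : set TA) g &
    forall B, A B -> \int[mu]_(x in B) f x = \int[mu]_(x in B) g x].
Proof.
move=> f0 intf.
have mf := measurable_int _ intf.
pose nu0 : set TA -> \bar R := fun B => \int[mu]_(x in B) f x.
have nu00 : nu0 set0 = 0 by rewrite /nu0 integral_set0.
have nu0_ge0 B : 0 <= nu0 B by exact: integral_ge0.
have nu0_add : semi_sigma_additive nu0.
  move=> F mF tF mUF; rewrite /nu0 ge0_integral_bigcup//; last 2 first.
    by move=> k; exact: sub_measurable.
    exact: measurable_funTS.
  by apply: is_cvg_ereal_nneg_natsum => n _; exact: integral_ge0.
have nu0_fin : fin_num_fun nu0.
  move=> B mB; apply: integrable_fin_num; first exact: sub_measurable.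
  by apply: integrableS intf => //; exact: sub_measurable.
pose nu : {measure set TA -> \bar R} := HB.pack nu0
  (isMeasure.Build _ _ _ nu0 nu00 nu0_ge0 nu0_add).
have [|||g [g0 mg gE]] := @radon_nikodym_measure _ TA R restr_measure nu.
- exact: restr_sigma_finite.
- exact: nu0_fin.
- move=> N N0 B mB BN; apply: null_set_integral; first exact: sub_measurable.
    exact: measurable_funTS.
  exact: (N0 B).
exists g; split=> // B AB; have mB : measurable (B : set TA) by exact/sub_measurableE.
by rewrite -[RHS]ge0_integral_restr//; exact: gE.
Qed.

(** * Existence and uniqueness of the conditional expectation *)

(** The measure with density [f] need not be sigma-finite on [A], so that the
    Radon-Nikodym theorem does not apply to [f] directly.  It applies to the
    restrictions of [f] to the disjoint sets [D k], on which [f <= k] and which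
    have finite measure.  The sum of the resulting densities is exactly
    nonnegative and measurable, with no a.e. correction to make. *)
Lemma condexp_ge0_exists (f : T -> R) :
  (forall x, (0 <= f x)%R) -> measurable_fun setT f ->
  exists g, is_condexp_ge0 mu A (EFin \o f) g.
Proof.
move=> f0 mf; have f0' x : 0 <= (EFin \o f) x by rewrite /= lee_fin.
have mf' : measurable_fun setT (EFin \o f) by exact/measurable_EFinP.
have [F [FT ndF Ffin]] := (sigma_finiteP _ _).1 restr_sigma_finite.
pose G k : set T := (F k : set T) `&` [set x | (f x)%:E <= k%:R%:E].
have mF k : d.-measurable (F k : set T) by exact: sub_measurable (Ffin k).1.
have mG k : d.-measurable (G k).
  apply: measurableI => //; rewrite -[X in measurable X]setTI.
  exact: (emeasurable_fun_infty_c measurableT mf').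
pose D := seqDU G.
have mD k : measurable (D k) by exact: seqDU_measurable.
have DG k : D k `<=` G k by move=> x [].
have DT : \bigcup_k D k = setT.
  rewrite -seqDU_bigcup_eq; apply/seteqP; split=> // x _.
  have : (\bigcup_k F k) x by rewrite -FT.
  move=> [i _ Fx]; exists (maxn i (Num.truncn (f x)).+1) => //; split.
    by move: Fx; apply/subsetPset/ndF; rewrite leq_maxl.
  by rewrite /= lee_fin (le_trans (ltW (truncnS_gt _)))// ler_nat leq_maxr.
have intf k : mu.-integrable setT ((EFin \o f) \_ (D k)).
  apply/(integrable_mkcond _ (mD k)); apply: measurable_bounded_integrable => //.
  - have : mu (F k) < +oo := (Ffin k).2.
    by apply: le_lt_trans; apply: le_measure; rewrite ?inE// => x /DG[].
  - exact: measurable_funTS.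
  - exists k%:R; split; first exact: num_real.
    move=> M kM x /DG[_ /=]; rewrite lee_fin => fk; rewrite /= ger0_norm//.
    exact: le_trans fk (ltW kM).
have fD0 k x : 0 <= ((EFin \o f) \_ (D k)) x.
  by rewrite patchE; case: ifPn.
(* D k is only measurable for the large sigma-algebra, which is harmless here:
   what is projected is the function f restricted to D k. *)
have /choice[g gP] k := sub_radon_nikodym (fD0 k) (intf k).
have g0 k x : 0 <= g k x by have [] := gP k.
have mg k : measurable_fun (setT : set TA) (g k) by have [] := gP k.
have mG' : measurable_fun (setT : set TA) (fun x => \sum_(k <oo) g k x).
  by have := @ge0_emeasurable_sum _ TA R setT g xpredT; apply.
exists (fun x => \sum_(k <oo) g k x); split.
- by move=> x; exact: nneseries_ge0.
- move=> B mB; apply/sub_measurableE; rewrite -[X in measurable X]setTI.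
  exact: mG'.
- move=> B AB; have mB : measurable B by exact: hA.2.
  rewrite integral_nneseries//; last first.
    by move=> k; apply: measurable_funTS; exact: sub_measurable_fun.
  transitivity (\int[mu]_(x in \bigcup_k (B `&` D k)) (EFin \o f) x).
    by rewrite -setI_bigcupr DT setIT.
  rewrite ge0_integral_bigcup//; last 3 first.
  + by move=> k; exact: measurableI.
  + exact: measurable_funTS.
  + exact/trivIset_setIl/trivIset_seqDU.
  apply: eq_eseriesr => k _.
  rewrite integral_mkcondr.
  by have [_ _ ->] := gP k.
Qed.

(** Uniqueness of densities is a statement about integrable functions.  It is
    used on the sets [F n] intersected with [g2 <= m], where [g2] is integrable;
    these cover the set where [g2] is finite. *)
Lemma sub_ae_eq_fin (g1 g2 : T -> \bar R) :
  measurable_fun (setT : set TA) g1 -> measurable_fun (setT : set TA) g2 ->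
  (forall x, 0 <= g1 x) -> (forall x, 0 <= g2 x) ->
  (forall B, A B -> \int[mu]_(x in B) g1 x = \int[mu]_(x in B) g2 x) ->
  {ae mu, forall x, g2 x < +oo -> g1 x = g2 x}.
Proof.
move=> mg1 mg2 g10 g20 g12.
have [F FT AF] := hfin.
pose D n m : set TA := F n `&` [set x | g2 x <= m%:R%:E].
have mF n : measurable (F n : set TA) by apply/sub_measurableE; have [] := AF n.
have mD n m : measurable (D n m).
  apply: measurableI => //; rewrite -[X in measurable X]setTI.
  exact: emeasurable_fun_infty_c.
have FD n m : mu (D n m) < +oo.
  have : mu (F n) < +oo by have [] := AF n.
  by apply: le_lt_trans; apply: le_measure; rewrite ?inE;
    [exact: sub_measurable..|move=> x []].
have eqD n m : {ae mu, forall x, D n m x -> g1 x = g2 x}.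
  have : ae_eq restr_measure (D n m) g2 g1.
    apply: integral_ae_eq => //.
    - apply/integrableP; split; first exact: measurable_funTS.
      under eq_integral do rewrite gee0_abs//.
      rewrite ge0_integral_restr//.
      apply: (@le_lt_trans _ _ (\int[mu]_(x in D n m) (cst m%:R%:E) x)).
        apply: ge0_le_integral => //; first exact: sub_measurable.
          by apply: measurable_funTS; exact: sub_measurable_fun.
        by move=> x [].
      rewrite integral_cst; last exact: sub_measurable.
      by rewrite lte_mul_pinfty// ?lee_fin.
    - exact: measurable_funTS.
    - move=> E _ mE; rewrite !ge0_integral_restr//.
      by rewrite g12//; exact/sub_measurableE.
  move=> [N [mN N0 DN]]; exists N; split => //; first exact: sub_measurable.
  by move=> x /= nx; apply: DN => /=; apply: contra_not nx => nx Dx; rewrite nx.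
have eqDn n : {ae mu, forall x, forall m, D n m x -> g1 x = g2 x}.
  exact: (ae_foralln (eqD n)).
have := ae_foralln eqDn.
apply: filterS => x Dx g2fin.
have : (\bigcup_i F i) x by rewrite FT.
move=> [n _ Fx]; apply: (Dx n (Num.truncn (fine (g2 x))).+1); split => //=.
by rewrite -[leLHS]fineK ?ge0_fin_numE// lee_fin ltW// truncnS_gt.
Qed.

(** Exchanging the two functions covers the points where either is finite; at
    the others both are infinite. *)
Lemma sub_ae_eq (g1 g2 : T -> \bar R) :
  measurable_fun (setT : set TA) g1 -> measurable_fun (setT : set TA) g2 ->
  (forall x, 0 <= g1 x) -> (forall x, 0 <= g2 x) ->
  (forall B, A B -> \int[mu]_(x in B) g1 x = \int[mu]_(x in B) g2 x) ->
  {ae mu, forall x, g1 x = g2 x}.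
Proof.
move=> mg1 mg2 g10 g20 g12.
have H1 := sub_ae_eq_fin mg1 mg2 g10 g20 g12.
have H2 := sub_ae_eq_fin mg2 mg1 g20 g10 (fun B AB => esym (g12 B AB)).
apply: filterS2 H1 H2 => x h1 h2.
have [/h1//|] := ltP (g2 x) +oo; rewrite leye_eq => /eqP g2y.
have [/h2//|] := ltP (g1 x) +oo; rewrite leye_eq => /eqP g1y.
by rewrite g1y g2y.
Qed.

(** * The pull-out formula for nonnegative functions *)

Import HBNNSimple.

Lemma integral_nnsfunM (h : {nnsfun TA >-> R}) (f : T -> \bar R) (B : set T) :
  measurable B -> (forall x, 0 <= f x) -> measurable_fun setT f ->
  \int[mu]_(x in B) ((h x)%:E * f x) =
  \sum_(y \in range h) (y%:E * \int[mu]_(x in B `&` h @^-1` [set y]) f x).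
Proof.
move=> mB f0 mf.
have mh y : d.-measurable (h @^-1` [set y] : set T).
  apply: sub_measurable; rewrite -[X in measurable X]setTI.
  exact: (measurable_funPT h).
have mi y : measurable_fun B (fun x : T => (\1_(h @^-1` [set y]) x)%:E : \bar R).
  by apply/measurable_EFinP/measurable_indic.
transitivity (\int[mu]_(x in B)
    (\sum_(y \in range h) (y%:E * ((\1_(h @^-1` [set y]) x)%:E * f x)))).
  apply: eq_integral => x _.
  under eq_fsbigr do rewrite muleA -EFinM.
  rewrite -ge0_mule_fsuml => [|y]; last by rewrite EFinM nnfun_muleindic_ge0.
  by rewrite fsumEFin//; congr (_%:E * _); exact: fimfunE.
rewrite ge0_integral_fsum//; last 2 first.
- move=> y; apply: emeasurable_funM => //.
  by apply: emeasurable_funM => //; exact: measurable_funTS.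
- by move=> y x _; rewrite muleA mule_ge0// nnfun_muleindic_ge0.
apply: eq_fsbigr => y; rewrite inE => -[t _ <-].
rewrite ge0_integralZl//.
- congr (_ * _).
  rewrite integral_mkcondr; apply: eq_integral => x _.
  by rewrite patchE indicE; case: ifPn => _; rewrite ?mul1e ?mul0e.
- by apply: emeasurable_funM => //; exact: measurable_funTS.
- by move=> x _; rewrite mule_ge0// lee_fin.
- by rewrite lee_fin.
Qed.

(** Equality of the integrals of [f1] and [f2] over the members of [A] is the
    case where [h] is an indicator.  It passes to simple functions by linearity,
    and to [h] by monotone convergence. *)
Lemma sub_integralM (f1 f2 : T -> \bar R) (h : T -> R) :
  (forall x, 0 <= f1 x) -> (forall x, 0 <= f2 x) ->
  measurable_fun setT f1 -> measurable_fun setT f2 ->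
  (forall B, A B -> \int[mu]_(x in B) f1 x = \int[mu]_(x in B) f2 x) ->
  (forall x, (0 <= h x)%R) -> measurable_fun (setT : set TA) h ->
  forall B, A B ->
  \int[mu]_(x in B) ((h x)%:E * f1 x) = \int[mu]_(x in B) ((h x)%:E * f2 x).
Proof.
move=> f10 f20 mf1 mf2 f12 h0 mh B AB.
have mB : d.-measurable B by exact: hA.2.
have mh' : measurable_fun (setT : set TA) (EFin \o h) by exact/measurable_EFinP.
pose phi := nnsfun_approx (measurableT : measurable (setT : set TA)) mh'.
have phi_cvg x : EFin \o phi^~ x @ \oo --> (h x)%:E.
  by apply: cvg_nnsfun_approx => // y _; rewrite /= lee_fin.
have phi_nd x : nondecreasing_seq (phi^~ x).
  by move=> m n mn; exact/lefP/nd_nnsfun_approx.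
have phi0 n x : (0 <= phi n x)%R by [].
suff lim_phi f : (forall x, 0 <= f x) -> measurable_fun setT f ->
    \int[mu]_(x in B) ((h x)%:E * f x) =
    limn (fun n => \int[mu]_(x in B) ((phi n x)%:E * f x)).
  rewrite !lim_phi//; congr (limn _); apply/funext => n.
  rewrite !integral_nnsfunM//; apply: eq_fsbigr => y _; congr (_ * _).
  apply: f12; apply/sub_measurableE; apply: measurableI.
    exact/sub_measurableE.
  by rewrite -[X in measurable X]setTI; exact: (measurable_funPT (phi n)).
move=> f0 mf; rewrite -monotone_convergence//.
- apply: eq_integral => x _; apply/esym/cvg_lim => //.
  have [hx0|hx0] := eqVneq (h x) 0%R.
    (* The product of limits is not continuous at 0 * oo, but the approximations
       increase to h x and therefore vanish wherever h does. *)
    have phix n : phi n x = 0%R.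
      apply/le_anti; rewrite phi0 andbT -hx0 -lee_fin.
      have ndE : nondecreasing_seq (EFin \o phi^~ x).
        by move=> m k mk; rewrite /= lee_fin phi_nd.
      rewrite -(cvg_unique _ (ereal_nondecreasing_cvgn ndE) (phi_cvg x))//.
      by apply: ereal_sup_ubound; exists n.
    by rewrite hx0; under eq_fun do rewrite phix mul0e; rewrite mul0e; exact: cvg_cst.
  apply: cvgeM; [|exact: phi_cvg|exact: cvg_cst].
  have [ffin|finfty] := boolP (f x \is a fin_num); first exact: mule_def_fin.
  by apply: mule_def_neq0_infty => //; rewrite eqe.
- move=> n.
  have mphi : measurable_fun (setT : set T) (fun x : T => (phi n x)%:E).
    by apply: sub_measurable_fun; exact/measurable_EFinP.
  by apply: (@emeasurable_funM _ T R B (fun x => (phi n x)%:E) f);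
    exact: measurable_funTS.
- by move=> n x _; rewrite mule_ge0// lee_fin.
- by move=> x _ m n mn; rewrite lee_wpmul2r// lee_fin phi_nd.
Qed.

(** * Conditional expectation of nonnegative functions *)

Local Notation CE f := (condexp_ge0 mu A (EFin \o f)).

Lemma is_condexp_measurable (f g : T -> \bar R) :
  is_condexp_ge0 mu A f g -> measurable_fun (setT : set TA) g.
Proof. by move=> [_ mg _] _ B mB; rewrite setTI; exact/sub_measurableE/mg. Qed.

Lemma is_condexpI (f g : T -> \bar R) : (forall x, 0 <= g x) ->
  measurable_fun (setT : set TA) g ->
  (forall B, A B -> \int[mu]_(x in B) f x = \int[mu]_(x in B) g x) ->
  is_condexp_ge0 mu A f g.
Proof.
move=> g0 mg fg; split=> // B mB; apply/sub_measurableE.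
by rewrite -[X in measurable X]setTI; exact: mg.
Qed.

Lemma condexp_ge0P (f : T -> R) :
  (forall x, (0 <= f x)%R) -> measurable_fun setT f ->
  is_condexp_ge0 mu A (EFin \o f) (CE f).
Proof. by move=> f0 mf; exact: xgetPex (condexp_ge0_exists f0 mf). Qed.

Lemma condexp_ge0_ge0 (f : T -> \bar R) x : 0 <= condexp_ge0 mu A f x.
Proof. by rewrite /condexp_ge0; case: xgetP => // g -> []. Qed.

Lemma condexp_ge0_measurable (f : T -> \bar R) :
  measurable_fun (setT : set TA) (condexp_ge0 mu A f).
Proof.
rewrite /condexp_ge0; case: xgetP => [g _|_]; last exact: measurable_cst.
exact: is_condexp_measurable.
Qed.

Lemma condexp_ge0_unique (f g : T -> \bar R) : is_condexp_ge0 mu A f g ->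
  {ae mu, forall x, condexp_ge0 mu A f x = g x}.
Proof.
move=> fg; have [E0 mE EE] : is_condexp_ge0 mu A f (condexp_ge0 mu A f).
  exact: xgetPex (ex_intro _ _ fg).
apply: sub_ae_eq => //; [exact: condexp_ge0_measurable|
  exact: is_condexp_measurable fg|by case: fg|].
by move=> B AB; rewrite -EE//; case: fg => _ _; exact.
Qed.

(** The equality holds everywhere, and not only a.e., because the chosen version
    depends only on the integrals of the function over the members of [A]. *)
Lemma condexp_ge0_ext (f g : T -> R) :
  measurable_fun setT f -> measurable_fun setT g ->
  {ae mu, forall x, f x = g x} -> CE f = CE g.
Proof.
move=> mf mg fg; rewrite /condexp_ge0; congr (xget _ _).
have fgE B : A B -> \int[mu]_(x in B) (EFin \o f) x =
    \int[mu]_(x in B) (EFin \o g) x.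
  move=> AB; apply: ae_eq_integral; first exact: hA.2.
  - by apply: measurable_funTS; exact/measurable_EFinP.
  - by apply: measurable_funTS; exact/measurable_EFinP.
  - by apply: filterS fg => x /= ->.
by apply/seteqP; split => h [h0 mh hE]; split => // B AB;
  rewrite -hE// fgE.
Qed.

Lemma condexp_ge0D (f g : T -> R) :
  (forall x, (0 <= f x)%R) -> measurable_fun setT f ->
  (forall x, (0 <= g x)%R) -> measurable_fun setT g ->
  {ae mu, forall x, CE (f \+ g)%R x = CE f x + CE g x}.
Proof.
move=> f0 mf g0 mg; apply: condexp_ge0_unique; apply: is_condexpI.
- by move=> x; rewrite adde_ge0 ?condexp_ge0_ge0.
- by apply: emeasurable_funD; exact: condexp_ge0_measurable.
move=> B AB; have mB : d.-measurable B by exact: hA.2.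
rewrite ge0_integralD//; last 4 first.
- by move=> x _; exact: condexp_ge0_ge0.
- by apply: measurable_funTS; apply: sub_measurable_fun; exact: condexp_ge0_measurable.
- by move=> x _; exact: condexp_ge0_ge0.
- by apply: measurable_funTS; apply: sub_measurable_fun; exact: condexp_ge0_measurable.
have [_ _ <-//] := condexp_ge0P f0 mf; have [_ _ <-//] := condexp_ge0P g0 mg.
rewrite -ge0_integralD//.
- by move=> x _ /=; rewrite lee_fin.
- by apply: measurable_funTS; exact/measurable_EFinP.
- by move=> x _ /=; rewrite lee_fin.
- by apply: measurable_funTS; exact/measurable_EFinP.
Qed.

Lemma condexp_ge0M (h f : T -> R) :
  (forall x, (0 <= h x)%R) -> measurable_fun (setT : set TA) h ->
  (forall x, (0 <= f x)%R) -> measurable_fun setT f ->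
  {ae mu, forall x, CE (h \* f)%R x = (h x)%:E * CE f x}.
Proof.
move=> h0 mh f0 mf; apply: condexp_ge0_unique; apply: is_condexpI.
- by move=> x; rewrite mule_ge0 ?condexp_ge0_ge0// lee_fin.
- apply: emeasurable_funM; last exact: condexp_ge0_measurable.
  exact/measurable_EFinP.
move=> B AB.
under eq_integral do rewrite /= EFinM.
apply: (sub_integralM (f1 := EFin \o f)) => //.
- by move=> x; exact: condexp_ge0_ge0.
- exact/measurable_EFinP.
- by apply: sub_measurable_fun; exact: condexp_ge0_measurable.
- by have [] := condexp_ge0P f0 mf.
Qed.

Lemma condexp_ge0_le (f g : T -> R) :
  (forall x, (0 <= f x)%R) -> measurable_fun setT f ->
  measurable_fun setT g -> (forall x, (f x <= g x)%R) ->
  {ae mu, forall x, CE f x <= CE g x}.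
Proof.
move=> f0 mf mg fg.
have : {ae mu, forall x, CE (f \+ (g \- f))%R x = CE f x + CE (g \- f)%R x}.
  apply: condexp_ge0D => //; first by move=> x; rewrite /= subr_ge0.
  exact: measurable_funB.
apply: filterS => x.
rewrite (_ : EFin \o (f \+ (g \- f))%R = EFin \o g); last first.
  by apply/funext => y /=; rewrite addrC subrK.
by move=> ->; rewrite leeDl// condexp_ge0_ge0.
Qed.

Local Close Scope ereal_scope.

Lemma condexp_real_measurable (f : T -> R) :
  measurable_fun (setT : set TA) (condexp_real mu A f).
Proof.
apply: measurable_funB; apply: measurableT_comp => //;
  exact: condexp_ge0_measurable.
Qed.

(** * Conditional expectation of real functions *)

(** This is the domain of the conditional expectation: both parts have a finite
    one, so that their difference is not affected by the junk value of [fine] at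
    infinity. *)
Definition cond_integrable_real (f : T -> R) : Prop :=
  [/\ measurable_fun setT f, {ae mu, forall x, (CE (f^\+)%R x < +oo)%E} &
    {ae mu, forall x, (CE (f^\-)%R x < +oo)%E}].

Lemma condexp_real_ext (f g : T -> R) :
  measurable_fun setT f -> measurable_fun setT g ->
  {ae mu, forall x, f x = g x} -> condexp_real mu A f = condexp_real mu A g.
Proof.
move=> mf mg fg; rewrite /condexp_real.
rewrite (@condexp_ge0_ext f^\+ g^\+); last first.
- by apply: filterS fg => x; rewrite /funrpos => ->.
- exact: measurable_funrpos.
- exact: measurable_funrpos.
rewrite (@condexp_ge0_ext f^\- g^\-)//.
- exact: measurable_funrneg.
- exact: measurable_funrneg.
- by apply: filterS fg => x; rewrite /funrneg => ->.
Qed.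

(** The positive and negative parts are neither additive nor multiplicative, so
    the algebraic rules are proved with arbitrary decompositions [f = a - b].
    The identity [f^+ + b = f^- + a] between nonnegative functions shows that
    all decompositions give the same value. *)
Lemma condexp_real_sub (f a b : T -> R) :
  (forall x, 0 <= a x) -> measurable_fun setT a ->
  (forall x, 0 <= b x) -> measurable_fun setT b ->
  {ae mu, forall x, (CE a x < +oo)%E} -> {ae mu, forall x, (CE b x < +oo)%E} ->
  (forall x, f x = a x - b x) ->
  cond_integrable_real f /\
  {ae mu, forall x, condexp_real mu A f x = fine (CE a x) - fine (CE b x)}.
Proof.
move=> a0 ma b0 mb afin bfin fE.
have mf : measurable_fun setT f.
  by rewrite (_ : f = a \- b); [exact: measurable_funB|exact/funext].
have mfp := measurable_funrpos mf; have mfn := measurable_funrneg mf.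
have pfin : {ae mu, forall x, (CE (f^\+)%R x < +oo)%E}.
  have le x : f^\+ x <= a x.
    by rewrite /funrpos fE ge_max a0 gerBl b0.
  apply: filterS2 afin (condexp_ge0_le (funrpos_ge0 f) mfp ma le) => x /[swap].
  exact: le_lt_trans.
have nfin : {ae mu, forall x, (CE (f^\-)%R x < +oo)%E}.
  have le x : f^\- x <= b x.
    by rewrite /funrneg fE ge_max b0 opprB gerBl a0.
  apply: filterS2 bfin (condexp_ge0_le (funrneg_ge0 f) mfn mb le) => x /[swap].
  exact: le_lt_trans.
split; first by split.
have D1 := condexp_ge0D (funrpos_ge0 f) mfp b0 mb.
have D2 := condexp_ge0D (funrneg_ge0 f) mfn a0 ma.
have E12 : f^\+ \+ b = f^\- \+ a.
  have Ef x : f^\+ x - f^\- x = f x by have /(congr1 (@^~ x)) := funrposBneg f.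
  by apply/funext => x /=; have := Ef x; rewrite fE; lra.
rewrite E12 in D1.
have fin g x : (CE g x < +oo)%E -> CE g x = (fine (CE g x))%:E.
  by move=> gx; rewrite fineK// ge0_fin_numE ?condexp_ge0_ge0.
have aeP := aeI (aeI (aeI pfin nfin) (aeI afin bfin)) (aeI D1 D2).
apply: filterS aeP => x [[[/fin px /fin nx] [/fin ax /fin bx]] [-> ]].
have sub_eq (p n r t : R) : p + t = n + r -> p - n = r - t by lra.
by rewrite /condexp_real px nx ax bx => -[]; exact: sub_eq.
Qed.

Lemma cond_integrable_realD (f g : T -> R) :
  cond_integrable_real f -> cond_integrable_real g ->
  cond_integrable_real (f \+ g) /\
  {ae mu, forall x,
    condexp_real mu A (f \+ g) x = condexp_real mu A f x + condexp_real mu A g x}.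
Proof.
move=> [mf fp fn] [mg gp gn].
have mfp := measurable_funrpos mf; have mfn := measurable_funrneg mf.
have mgp := measurable_funrpos mg; have mgn := measurable_funrneg mg.
have Dp := condexp_ge0D (funrpos_ge0 f) mfp (funrpos_ge0 g) mgp.
have Dn := condexp_ge0D (funrneg_ge0 f) mfn (funrneg_ge0 g) mgn.
have [||||||x|fgint fgE] :=
    @condexp_real_sub (f \+ g) (f^\+ \+ g^\+) (f^\- \+ g^\-).
- by move=> x; rewrite addr_ge0 ?funrpos_ge0.
- exact: measurable_funD.
- by move=> x; rewrite addr_ge0 ?funrneg_ge0.
- exact: measurable_funD.
- by apply: filterS3 Dp fp gp => x -> ? ?; rewrite lte_add_pinfty.
- by apply: filterS3 Dn fn gn => x -> ? ?; rewrite lte_add_pinfty.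
- have /(congr1 (@^~ x)) := funrposBneg f; have /(congr1 (@^~ x)) := funrposBneg g.
  by rewrite !fctE /=; lra.
split=> //.
have aeP := aeI (aeI (aeI fp fn) (aeI gp gn))
  (aeI fgE (aeI Dp Dn)).
apply: filterS aeP => x [[[px nx] [qx mx]] [-> [-> ->]]].
have fin k : (CE k x < +oo)%E -> (CE k x \is a fin_num)%E.
  by rewrite ge0_fin_numE ?condexp_ge0_ge0.
by rewrite /condexp_real (fineD (fin _ px) (fin _ qx)) (fineD (fin _ nx) (fin _ mx))
  opprD addrACA.
Qed.

(** With [h = h^+ - h^-] and [f = f^+ - f^-], the product is the difference of
    [h^+ f^+ + h^- f^-] and [h^+ f^- + h^- f^+], where the pull-out formula for
    nonnegative functions applies to each term. *)
Lemma cond_integrable_realM (h f : T -> R) :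
  measurable_fun (setT : set TA) h -> cond_integrable_real f ->
  cond_integrable_real (h \* f) /\
  {ae mu, forall x, condexp_real mu A (h \* f) x = h x * condexp_real mu A f x}.
Proof.
move=> mh [mf fp fn].
have mfp := measurable_funrpos mf; have mfn := measurable_funrneg mf.
have mhp := measurable_funrpos mh; have mhn := measurable_funrneg mh.
have mhp' := sub_measurable_fun mhp; have mhn' := sub_measurable_fun mhn.
have Mpp := condexp_ge0M (funrpos_ge0 h) mhp (funrpos_ge0 f) mfp.
have Mnn := condexp_ge0M (funrneg_ge0 h) mhn (funrneg_ge0 f) mfn.
have Mpn := condexp_ge0M (funrpos_ge0 h) mhp (funrneg_ge0 f) mfn.
have Mnp := condexp_ge0M (funrneg_ge0 h) mhn (funrpos_ge0 f) mfp.
have pp0 x : 0 <= (h^\+ \* f^\+) x by rewrite mulr_ge0 ?funrpos_ge0.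
have nn0 x : 0 <= (h^\- \* f^\-) x by rewrite mulr_ge0 ?funrneg_ge0.
have pn0 x : 0 <= (h^\+ \* f^\-) x by rewrite mulr_ge0 ?funrpos_ge0 ?funrneg_ge0.
have np0 x : 0 <= (h^\- \* f^\+) x by rewrite mulr_ge0 ?funrpos_ge0 ?funrneg_ge0.
have mpp : measurable_fun setT (h^\+ \* f^\+) by exact: measurable_funM.
have mnn : measurable_fun setT (h^\- \* f^\-) by exact: measurable_funM.
have mpn : measurable_fun setT (h^\+ \* f^\-) by exact: measurable_funM.
have mnp : measurable_fun setT (h^\- \* f^\+) by exact: measurable_funM.
have Dp := condexp_ge0D pp0 mpp nn0 mnn.
have Dn := condexp_ge0D pn0 mpn np0 mnp.
have fin g (r : R) x : (CE g x < +oo)%E ->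
    (r%:E * CE g x = (r * fine (CE g x))%:E)%E.
  by move=> gx; rewrite EFinM fineK// ge0_fin_numE ?condexp_ge0_ge0.
have CEp : {ae mu, forall x, CE ((h^\+ \* f^\+) \+ (h^\- \* f^\-))%R x =
    (h^\+ x * fine (CE (f^\+)%R x) + h^\- x * fine (CE (f^\-)%R x))%:E}.
  have aeP := aeI (aeI fp fn) (aeI Dp (aeI Mpp Mnn)).
  by apply: filterS aeP => x [[px nx] [-> [-> ->]]]; rewrite !fin.
have CEn : {ae mu, forall x, CE ((h^\+ \* f^\-) \+ (h^\- \* f^\+))%R x =
    (h^\+ x * fine (CE (f^\-)%R x) + h^\- x * fine (CE (f^\+)%R x))%:E}.
  have aeP := aeI (aeI fp fn) (aeI Dn (aeI Mpn Mnp)).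
  by apply: filterS aeP => x [[px nx] [-> [-> ->]]]; rewrite !fin.
have hE x : h x = h^\+ x - h^\- x.
  by have /(congr1 (@^~ x)) := funrposBneg h.
have fE x : f x = f^\+ x - f^\- x.
  by have /(congr1 (@^~ x)) := funrposBneg f.
have [||||||x|hfint hfE] := @condexp_real_sub (h \* f)
    ((h^\+ \* f^\+) \+ (h^\- \* f^\-)) ((h^\+ \* f^\-) \+ (h^\- \* f^\+)).
- by move=> x; rewrite addr_ge0.
- exact: measurable_funD.
- by move=> x; rewrite addr_ge0.
- exact: measurable_funD.
- by apply: filterS CEp => x ->; rewrite ltry.
- by apply: filterS CEn => x ->; rewrite ltry.
- by rewrite /= hE fE; ring.
split=> //.
apply: filterS3 hfE CEp CEn => x -> -> ->.
by rewrite /condexp_real /= hE; ring.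
Qed.

(** * Conditional expectation of complex functions *)

Definition cond_integrable (f : T -> R[i]) : Prop :=
  cond_integrable_real (fun x => complex.Re (f x)) /\
  cond_integrable_real (fun x => complex.Im (f x)).

Definition sub_complex_measurable (f : T -> R[i]) : Prop :=
  complex_measurable (f : TA -> R[i]).

Lemma sub_complex_measurableW f :
  sub_complex_measurable f -> complex_measurable f.
Proof. by move=> [? ?]; split; exact: sub_measurable_fun. Qed.

Lemma condexp_measurable f : sub_complex_measurable (condexp mu A f).
Proof. by split; exact: condexp_real_measurable. Qed.

Lemma condexp_ext f g : complex_measurable f -> complex_measurable g ->
  ae_eq mu setT f g -> condexp mu A f = condexp mu A g.
Proof.
move=> [mrf mif] [mrg mig] fg.
have reE : condexp_real mu A (fun x => complex.Re (f x)) =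
    condexp_real mu A (fun x => complex.Re (g x)).
  by apply: condexp_real_ext => //; apply: filterS fg => y ->.
have imE : condexp_real mu A (fun x => complex.Im (f x)) =
    condexp_real mu A (fun x => complex.Im (g x)).
  by apply: condexp_real_ext => //; apply: filterS fg => y ->.
by rewrite /condexp reE imE.
Qed.

Lemma condexpD f g : cond_integrable f -> cond_integrable g ->
  cond_integrable (fun x => f x + g x) /\
  ae_eq mu setT (condexp mu A (fun x => f x + g x))
    (fun x => condexp mu A f x + condexp mu A g x).
Proof.
move=> [rf jf] [rg jg].
have [rfg rE] := cond_integrable_realD rf rg.
have [jfg jE] := cond_integrable_realD jf jg.
have reE : (fun x => complex.Re (f x + g x)) =
    (fun x => complex.Re (f x)) \+ (fun x => complex.Re (g x)).
  by apply/funext => x /=; case: (f x) (g x) => a b [c e].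
have imE : (fun x => complex.Im (f x + g x)) =
    (fun x => complex.Im (f x)) \+ (fun x => complex.Im (g x)).
  by apply/funext => x /=; case: (f x) (g x) => a b [c e].
split; first by rewrite /cond_integrable reE imE.
rewrite /ae_eq /condexp reE imE.
by apply: filterS2 rE jE => x -> ->.
Qed.

(** Taking [h] constant, this also gives homogeneity of the conditional
    expectation over the complex numbers. *)
Lemma condexpM h f : sub_complex_measurable h -> cond_integrable f ->
  cond_integrable (fun x => h x * f x) /\
  ae_eq mu setT (condexp mu A (fun x => h x * f x))
    (fun x => h x * condexp mu A f x).
Proof.
move=> [mr mi] [rf jf].
have mNi : measurable_fun (setT : set TA) (\- (fun x => complex.Im (h x))).
  exact: measurable_funN.
have [rr rrE] := cond_integrable_realM mr rf.
have [ii iiE] := cond_integrable_realM mNi jf.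
have [ri riE] := cond_integrable_realM mr jf.
have [ir irE] := cond_integrable_realM mi rf.
have [Dr DrE] := cond_integrable_realD rr ii.
have [Di DiE] := cond_integrable_realD ri ir.
set a := _ \+ _ in Dr DrE; set b := _ \+ _ in Di DiE.
have reE : (fun x => complex.Re (h x * f x)) = a.
  by apply/funext => x /=; rewrite /a /=; case: (f x) (h x) => p q [r s] /=; ring.
have imE : (fun x => complex.Im (h x * f x)) = b.
  by apply/funext => x /=; rewrite /b /=; case: (f x) (h x) => p q [r s] /=; ring.
split; first by rewrite /cond_integrable reE imE.
rewrite /ae_eq /condexp reE imE.
have aeP := aeI (aeI rrE iiE) (aeI (aeI riE irE) (aeI DrE DiE)).
apply: filterS aeP => x [[rrx iix] [[rix irx] [-> ->]]] _.
rewrite rrx iix rix irx /=.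
move: (condexp_real _ _ _ x) (condexp_real _ _ _ x) (h x) => p q [r s] /=.
by congr (_ +i* _) => /=; ring.
Qed.

End Restriction.

(** * Modulus and measurability of complex functions *)

Section ComplexMeasurable.
Context {d : measure_display} {T : measurableType d} {R : realType}.
Implicit Types (z w : R[i]) (f g : T -> R[i]).

Lemma cmodE z : cmod z = Normc.normc z. Proof. by []. Qed.

Lemma cmod_ge0 z : 0 <= cmod z.
Proof. by rewrite cmodE; case: z => a b; exact: sqrtr_ge0. Qed.

Lemma cmod0 : cmod (0 : R[i]) = 0. Proof. by rewrite cmodE Normc.normc0. Qed.

Lemma cmod_eq0 z : cmod z = 0 -> z = 0.
Proof. by rewrite cmodE; exact: Normc.eq0_normc. Qed.

Lemma cmod_gt0 z : z != 0 -> 0 < cmod z.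
Proof.
move=> z0; rewrite lt_neqAle cmod_ge0 andbT eq_sym.
by apply: contra z0 => /eqP/cmod_eq0 ->.
Qed.

Lemma cmodM z w : cmod (z * w) = cmod z * cmod w.
Proof. by rewrite !cmodE Normc.normcM. Qed.

Lemma cmodV z : cmod z^-1 = (cmod z)^-1.
Proof. by rewrite !cmodE Normc.normcV. Qed.

Lemma cmodN z : cmod (- z) = cmod z.
Proof. by rewrite !cmodE normcN. Qed.

Lemma cmod_real (r : R) : cmod r%:C = `|r|.
Proof. by rewrite cmodE /= expr0n addr0 sqrtr_sqr. Qed.

Lemma ler_cmodD z w : cmod (z + w) <= cmod z + cmod w.
Proof. by rewrite !cmodE le_normcD. Qed.

Lemma normRe_le_cmod z : `|complex.Re z| <= cmod z.
Proof. by have := normc_ge_Re z; rewrite lecE => /andP[]. Qed.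

Lemma normIm_le_cmod z : `|complex.Im z| <= cmod z.
Proof.
case: z => a b; rewrite cmodE /= -sqrtr_sqr.
by rewrite ler_wsqrtr// lerDr sqr_ge0.
Qed.

Lemma cmod_measurable f :
  complex_measurable f -> measurable_fun setT (fun x => cmod (f x)).
Proof.
move=> [mr mi].
rewrite (_ : (fun x => _) =
    Num.sqrt \o (fun x => complex.Re (f x) ^+ 2 + complex.Im (f x) ^+ 2)); last first.
  by apply/funext => x; rewrite cmodE /=; case: (f x).
apply: measurableT_comp.
  by apply: continuous_measurable_fun; exact: sqrt_continuous.
by apply: measurable_funD; exact: measurable_funX.
Qed.

Lemma complex_measurable_real (r : T -> R) : measurable_fun setT r ->
  complex_measurable (fun x => (r x)%:C).
Proof. by move=> mr; split => //=; exact: measurable_cst. Qed.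

Lemma complex_measurable_cst z : complex_measurable (cst z : T -> R[i]).
Proof. by split; exact: measurable_cst. Qed.

Lemma complex_measurableD f g : complex_measurable f -> complex_measurable g ->
  complex_measurable (fun x => f x + g x).
Proof.
move=> [fr fi] [gr gi]; split.
- rewrite (_ : (fun x => _) =
    (fun x => complex.Re (f x)) \+ (fun x => complex.Re (g x))).
    exact: measurable_funD.
  by apply/funext => x /=; case: (f x) (g x) => a b [].
- rewrite (_ : (fun x => _) =
    (fun x => complex.Im (f x)) \+ (fun x => complex.Im (g x))).
    exact: measurable_funD.
  by apply/funext => x /=; case: (f x) (g x) => a b [].
Qed.

Lemma complex_measurableM f g : complex_measurable f -> complex_measurable g ->
  complex_measurable (fun x => f x * g x).
Proof.
move=> [fr fi] [gr gi]; split.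
- rewrite (_ : (fun x => _) = (fun x => complex.Re (f x)) \* (fun x => complex.Re (g x))
    \- (fun x => complex.Im (f x)) \* (fun x => complex.Im (g x))).
    by apply: measurable_funB; exact: measurable_funM.
  by apply/funext => x /=; case: (f x) (g x) => a b [].
- rewrite (_ : (fun x => _) = (fun x => complex.Re (f x)) \* (fun x => complex.Im (g x))
    \+ (fun x => complex.Im (f x)) \* (fun x => complex.Re (g x))).
    by apply: measurable_funD; exact: measurable_funM.
  by apply/funext => x /=; case: (f x) (g x) => a b [].
Qed.

(** The real inverse is measurable as a power function with exponent [-1]; the
    two agree on nonnegative reals, zero included. *)
Lemma complex_measurableV f : complex_measurable f ->
  complex_measurable (fun x => (f x)^-1).
Proof.
move=> [fr fi].
pose n2 x := complex.Re (f x) ^+ 2 + complex.Im (f x) ^+ 2.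
have n20 x : 0 <= n2 x by rewrite addr_ge0 ?sqr_ge0.
have mn2 : measurable_fun setT (fun x => (n2 x)^-1).
  rewrite (_ : (fun x => _) = (@powR R ^~ (-1)) \o n2); last first.
    by apply/funext => x; rewrite /= powR_inv1.
  apply: measurableT_comp; first exact: measurable_powR.
  by apply: measurable_funD; exact: measurable_funX.
split.
- rewrite (_ : (fun x => _) = (fun x => complex.Re (f x)) \* (fun x => (n2 x)^-1)).
    exact: measurable_funM.
  by apply/funext => x; rewrite /n2 /=; case: (f x).
- rewrite (_ : (fun x => _) = \- ((fun x => complex.Im (f x)) \* (fun x => (n2 x)^-1))).
    by apply: measurable_funN; exact: measurable_funM.
  by apply/funext => x; rewrite /n2 /=; case: (f x).
Qed.

End ComplexMeasurable.

(** * Young functions and the Luxemburg norm *)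

Section Young.
Context {R : realType}.
Variables (Phi : R -> R).
Hypothesis hPhi : young_function Phi.

Lemma young_convexE (t x y : R) : 0 <= t -> t <= 1 ->
  Phi (t * x + (1 - t) * y) <= t * Phi x + (1 - t) * Phi y.
Proof.
move=> t0 t1.
exact: (young_convex hPhi (Itv01 t0 t1) (in_setT x) (in_setT y)).
Qed.

Lemma young0 : Phi 0 = 0. Proof. exact/(young_eq0 hPhi). Qed.

(** Convexity between [0] and [x], since [Phi] vanishes at [0].  This inequality
    gives the monotonicity of [Phi], its growth, and the fact that functions of
    finite modular can be scaled down to modular at most [1]. *)
Lemma young_scale (t x : R) : 0 <= t -> t <= 1 -> Phi (t * x) <= t * Phi x.
Proof.
move=> t0 t1; have := young_convexE x 0 t0 t1.
by rewrite young0 !mulr0 !addr0.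
Qed.

Lemma young_le (x y : R) : 0 <= x -> x <= y -> Phi x <= Phi y.
Proof.
move=> x0 xy; have [y0|y0] := eqVneq y 0.
  by have -> : x = y by apply/le_anti; rewrite xy y0 x0.
have y_gt0 : 0 < y by rewrite lt_neqAle eq_sym y0 (le_trans x0).
have t0 : 0 <= x / y by rewrite divr_ge0// ltW.
have t1 : x / y <= 1 by rewrite ler_pdivrMr// mul1r.
have := young_scale y t0 t1; rewrite divfK// => /le_trans; apply.
rewrite ger_pMl// lt_neqAle young_ge0// andbT eq_sym.
by apply: contra y0 => /eqP/(young_eq0 hPhi)->.
Qed.

Lemma young1_gt0 : 0 < Phi 1.
Proof.
rewrite lt_neqAle (young_ge0 hPhi) andbT eq_sym.
by apply/eqP => /(young_eq0 hPhi)/eqP; rewrite oner_eq0.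
Qed.

Lemma young_ge_linear (x : R) : 1 <= x -> x * Phi 1 <= Phi x.
Proof.
move=> x1; have x0 : 0 < x by rewrite (lt_le_trans ltr01).
have xV0 : 0 <= x^-1 by rewrite invr_ge0 ltW.
have xV1 : x^-1 <= 1 by rewrite invf_le1.
by have := young_scale x xV0 xV1; rewrite mulVf ?gt_eqF// mulrC ler_pdivlMr// mulrC.
Qed.

Lemma young_measurable : measurable_fun setT Phi.
Proof. by apply: continuous_measurable_fun; exact: young_continuous hPhi. Qed.

Context {d : measure_display} {T : measurableType d}.
Variable mu : {measure set T -> \bar R}.
Implicit Types f g : T -> R[i].

Definition luxemburg_set f : set R :=
  [set k | 0 < k /\ (orlicz_modular mu Phi k^-1 f <= 1)%E].

Lemma luxemburg_normE f : luxemburg_norm mu Phi f = inf (luxemburg_set f).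
Proof. by []. Qed.

Lemma modular_measurable k f : complex_measurable f ->
  measurable_fun setT (fun x => (Phi (k * cmod (f x)))%:E).
Proof.
move=> mf; apply/measurable_EFinP.
apply: (measurableT_comp young_measurable).
by apply: measurable_funM => //; exact: cmod_measurable.
Qed.

Lemma modular_le k c f g : complex_measurable f -> complex_measurable g ->
  0 <= k -> {ae mu, forall x, cmod (f x) <= c * cmod (g x)} ->
  (orlicz_modular mu Phi k f <= orlicz_modular mu Phi (k * c) g)%E.
Proof.
move=> mf mg k0 fg; apply: ae_ge0_le_integral => //.
- by move=> x _; rewrite lee_fin (young_ge0 hPhi).
- exact: modular_measurable.
- by move=> x _; rewrite lee_fin (young_ge0 hPhi).
- exact: modular_measurable.
apply: filterS fg => x fgx _; rewrite lee_fin young_le ?mulr_ge0 ?cmod_ge0//.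
by rewrite -mulrA ler_wpM2l.
Qed.

Lemma luxemburg_set_lbound f : has_lbound (luxemburg_set f).
Proof. by exists 0 => k [/ltW]. Qed.

Lemma luxemburg_norm_ge0 f : 0 <= luxemburg_norm mu Phi f.
Proof.
rewrite luxemburg_normE; have [->|/set0P ne] := eqVneq (luxemburg_set f) set0.
  by rewrite inf0.
by apply: lb_le_inf => // k [/ltW].
Qed.

Lemma luxemburg_set_orlicz f k : complex_measurable f -> luxemburg_set f k ->
  orlicz mu Phi f.
Proof.
move=> mf [k0 fk]; split => //; exists k^-1; first by rewrite invr_gt0.
by rewrite (le_lt_trans fk)// ltry.
Qed.

Lemma modular_scale k t f : complex_measurable f -> 0 <= t -> t <= 1 ->
  (orlicz_modular mu Phi (t * k) f <= t%:E * orlicz_modular mu Phi k f)%E.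
Proof.
move=> mf t0 t1; rewrite /orlicz_modular -ge0_integralZl//; last first.
- by move=> x _; rewrite lee_fin (young_ge0 hPhi).
- exact: modular_measurable.
apply: ge0_le_integral => //.
- by move=> x _; rewrite lee_fin (young_ge0 hPhi).
- exact: modular_measurable.
- by apply: measurable_funeM; exact: modular_measurable.
- by move=> x _; rewrite -EFinM lee_fin -mulrA young_scale.
Qed.

(** If the modular of [k f] is [I], then that of [t k f] is at most [t I], and
    [t = 1 / (1 + I)] brings it below [1]. *)
Lemma luxemburg_set_nonempty f : orlicz mu Phi f -> luxemburg_set f !=set0.
Proof.
move=> [mf [k k0 fk]].
have I0 : (0 <= orlicz_modular mu Phi k f)%E.
  by apply: integral_ge0 => x _; rewrite lee_fin (young_ge0 hPhi).
pose I := fine (orlicz_modular mu Phi k f).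
have IE : orlicz_modular mu Phi k f = I%:E by rewrite fineK// ge0_fin_numE.
have I_ge0 : 0 <= I by rewrite fine_ge0.
pose t := (1 + I)^-1.
have I1 : 0 < 1 + I by rewrite ltr_wpDr.
have t0 : 0 < t by rewrite invr_gt0.
have t1 : t <= 1 by rewrite invf_le1// lerDl.
exists (t * k)^-1; split; first by rewrite invr_gt0 mulr_gt0.
rewrite invrK; apply: (le_trans (modular_scale k mf (ltW t0) t1)).
by rewrite IE -EFinM lee_fin mulrC ler_pdivrMr// mul1r lerDr.
Qed.

Lemma luxemburg_set_le c f g k : complex_measurable f -> complex_measurable g ->
  0 < c -> {ae mu, forall x, cmod (f x) <= c * cmod (g x)} ->
  luxemburg_set g k -> luxemburg_set f (c * k).
Proof.
move=> mf mg c0 fg [k0 gk]; split; first by rewrite mulr_gt0.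
have ck0 : 0 <= (c * k)^-1 by rewrite invr_ge0 mulr_ge0 ?ltW.
apply: (le_trans (modular_le mf mg ck0 fg)).
by rewrite invfM mulrAC mulVf ?gt_eqF// mul1r.
Qed.

(** All boundedness estimates on the Orlicz space are reduced to this pointwise
    domination; with [c = 1] it also shows that the norm depends only on the
    a.e. class. *)
Lemma orlicz_le c f g : complex_measurable f -> orlicz mu Phi g ->
  0 < c -> {ae mu, forall x, cmod (f x) <= c * cmod (g x)} ->
  orlicz mu Phi f /\
  luxemburg_norm mu Phi f <= c * luxemburg_norm mu Phi g.
Proof.
move=> mf og c0 fg; have [mg _] := og.
have [k gk] := luxemburg_set_nonempty og.
split; first exact: luxemburg_set_orlicz (luxemburg_set_le mf mg c0 fg gk).
rewrite mulrC -ler_pdivrMr// !luxemburg_normE; apply: lb_le_inf; first by exists k.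
move=> j gj; rewrite ler_pdivrMr// mulrC.
by apply: ge_inf; [exact: luxemburg_set_lbound|exact: luxemburg_set_le gj].
Qed.

(** The argument [|f + g| / (j + k)] is at most the convex combination of
    [|f| / j] and [|g| / k] with weights [j / (j + k)] and [k / (j + k)]. *)
Lemma luxemburg_setD f g j k : complex_measurable f -> complex_measurable g ->
  luxemburg_set f j -> luxemburg_set g k ->
  luxemburg_set (fun x => f x + g x) (j + k).
Proof.
move=> mf mg [j0 fj] [k0 gk]; have jk0 : 0 < j + k by rewrite addr_gt0.
split=> //.
pose t := j / (j + k).
have t0 : 0 <= t by rewrite divr_ge0 ?ltW.
have t1 : t <= 1 by rewrite ler_pdivrMr// mul1r lerDl ltW.
have tE : 1 - t = k / (j + k) by rewrite /t; field; rewrite gt_eqF.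
have t1' : 0 <= 1 - t by rewrite subr_ge0.
apply: (@le_trans _ _
    (t%:E * orlicz_modular mu Phi j^-1 f + (1 - t)%:E * orlicz_modular mu Phi k^-1 g)%E).
  rewrite /orlicz_modular -!ge0_integralZl//; last 4 first.
  - exact: modular_measurable.
  - by move=> x _; rewrite lee_fin (young_ge0 hPhi).
  - exact: modular_measurable.
  - by move=> x _; rewrite lee_fin (young_ge0 hPhi).
  have mPf := modular_measurable j^-1 mf; have mPg := modular_measurable k^-1 mg.
  rewrite -ge0_integralD//; last 4 first.
  - by move=> x _; rewrite -EFinM lee_fin mulr_ge0// (young_ge0 hPhi).
  - exact: measurable_funeM.
  - by move=> x _; rewrite -EFinM lee_fin mulr_ge0// (young_ge0 hPhi).
  - exact: measurable_funeM.
  apply: ge0_le_integral => //.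
  - by move=> x _; rewrite lee_fin (young_ge0 hPhi).
  - by apply: modular_measurable; exact: complex_measurableD.
  - by apply: emeasurable_funD; exact: measurable_funeM.
  move=> x _; rewrite -!EFinM -EFinD lee_fin.
  apply: le_trans (young_convexE _ _ t0 t1).
  apply: young_le; first by rewrite mulr_ge0 ?cmod_ge0// invr_ge0 ltW.
  rewrite tE /t [leRHS](_ : _ = (j + k)^-1 * (cmod (f x) + cmod (g x))); last first.
    by field; rewrite !gt_eqF.
  by rewrite ler_wpM2l ?ler_cmodD// invr_ge0 ltW.
apply: (@le_trans _ _ (t%:E * 1 + (1 - t)%:E * 1)%E).
  by apply: leeD; apply: lee_wpmul2l => //; rewrite lee_fin.
by rewrite !mule1 -EFinD addrC subrK.
Qed.

Lemma orliczD f g : orlicz mu Phi f -> orlicz mu Phi g ->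
  orlicz mu Phi (fun x => f x + g x) /\
  luxemburg_norm mu Phi (fun x => f x + g x) <=
  luxemburg_norm mu Phi f + luxemburg_norm mu Phi g.
Proof.
move=> orf og; have [mf _] := orf; have [mg _] := og.
have [j fj] := luxemburg_set_nonempty orf.
have [k gk] := luxemburg_set_nonempty og.
split.
  apply: luxemburg_set_orlicz (luxemburg_setD mf mg fj gk).
  exact: complex_measurableD.
rewrite !luxemburg_normE -lerBlDr; apply: lb_le_inf; first by exists j.
move=> j' fj'; rewrite lerBlDr addrC -lerBlDr.
apply: lb_le_inf; first by exists k.
move=> k' gk'; rewrite lerBlDr addrC.
apply: ge_inf; first exact: luxemburg_set_lbound.
exact: luxemburg_setD.
Qed.

Lemma modular_indic k (B : set T) : measurable B ->
  orlicz_modular mu Phi k (fun x => (\1_B x)%:C) = ((Phi k)%:E * mu B)%E.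
Proof.
move=> mB; rewrite /orlicz_modular.
transitivity (\int[mu]_x ((Phi k)%:E * (\1_B x)%:E))%E.
  apply: eq_integral => x _; rewrite cmod_real indicE.
  by case: (x \in B); rewrite ?normr1 ?normr0 ?mulr1 ?mule1 ?mulr0 ?mule0 ?young0.
rewrite ge0_integralZl//.
- by rewrite integral_indic// setIT.
- by apply/measurable_EFinP; exact: measurable_indic.
- by rewrite lee_fin (young_ge0 hPhi).
Qed.

Lemma orlicz_indic (B : set T) : measurable B -> (mu B < +oo)%E ->
  orlicz mu Phi (fun x => (\1_B x)%:C).
Proof.
move=> mB Bfin; split.
  by apply: complex_measurable_real; exact: measurable_indic.
exists 1 => //; rewrite modular_indic//.
by rewrite lte_mul_pinfty// ?lee_fin ?(young_ge0 hPhi).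
Qed.

(** The modular of [1_B / k] is [Phi (1/k) mu B].  For [k < 1] it is at least
    [Phi 1 * mu B / k], so an admissible [k] is at least [1] or at least
    [Phi 1 * mu B]. *)
Lemma luxemburg_indic_gt0 (B : set T) : measurable B ->
  (0 < mu B)%E -> (mu B < +oo)%E ->
  0 < luxemburg_norm mu Phi (fun x => (\1_B x)%:C).
Proof.
move=> mB B0 Bfin.
have BE : mu B = (fine (mu B))%:E by rewrite fineK// ge0_fin_numE.
set m := fine (mu B) in BE.
have m0 : 0 < m by rewrite -lte_fin -BE.
apply: (@lt_le_trans _ _ (Num.min 1 (Phi 1 * m))).
  by rewrite lt_min ltr01 mulr_gt0// young1_gt0.
rewrite luxemburg_normE; apply: lb_le_inf.
  exact/luxemburg_set_nonempty/orlicz_indic.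
move=> k [k0]; rewrite modular_indic// BE -EFinM lee_fin => Pk.
rewrite ge_min; have [//|k1] := leP 1 k; rewrite /=.
have : 1 <= k^-1 by rewrite invf_ge1// ltW.
move=> /young_ge_linear kP.
have : k^-1 * Phi 1 * m <= 1 by rewrite (le_trans _ Pk)// ler_wpM2r// ltW.
by rewrite -mulrA mulrC ler_pdivrMr// mul1r.
Qed.

End Young.

(** * Conditional integrability and sigma-finiteness *)

Section CondIntegrable.
Context {d : measure_display} {T : measurableType d} {R : realType}.
Variables (mu : {measure set T -> \bar R}) (A : set (set T)).
Hypothesis hA : sub_sigma_algebra_of A.
Hypothesis hfin : sub_sigma_finite mu A.

Lemma condexp_defined_cond_integrable (f : T -> R[i]) : complex_measurable f ->
  condexp_defined mu A f -> cond_integrable mu A f.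
Proof.
move=> mf; rewrite /condexp_defined => fdef.
have [mr mi] := mf; have mc := cmod_measurable mf.
have dom (g : T -> R) : (forall x, 0 <= g x) -> measurable_fun setT g ->
    (forall x, g x <= cmod (f x)) ->
    {ae mu, forall x, (condexp_ge0 mu A (EFin \o g) x < +oo)%E}.
  move=> g0 mg gf; have := condexp_ge0_le hA hfin g0 mg mc gf.
  by move=> gf'; apply: filterS2 gf' fdef => x; exact: le_lt_trans.
have bound (r : R) z : `|r| <= z -> Num.max r 0 <= z /\ Num.max (- r) 0 <= z.
  move=> rz; have z0 : 0 <= z := le_trans (normr_ge0 r) rz.
  by rewrite !ge_max z0 !andbT; move: rz; rewrite ler_norml => /andP[]; lra.
split; (split; [by []|apply: dom|apply: dom]).
- exact: funrpos_ge0.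
- exact: measurable_funrpos.
- by move=> x; exact: (bound _ _ (normRe_le_cmod (f x))).1.
- exact: funrneg_ge0.
- exact: measurable_funrneg.
- by move=> x; exact: (bound _ _ (normRe_le_cmod (f x))).2.
- exact: funrpos_ge0.
- exact: measurable_funrpos.
- by move=> x; exact: (bound _ _ (normIm_le_cmod (f x))).1.
- exact: funrneg_ge0.
- exact: measurable_funrneg.
- by move=> x; exact: (bound _ _ (normIm_le_cmod (f x))).2.
Qed.

Lemma indic_sub_measurable (B : set T) : A B ->
  measurable_fun (setT : set (g_sigma_algebraType A)) (\1_B : T -> R).
Proof.
by move=> AB; apply: (@measurable_indic _ (g_sigma_algebraType A));
  exact/sub_measurableE.
Qed.

(** On [B] in [A] the conditional expectation of [|f|] is that of [|f| 1_B], and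
    countably many members of [A] of finite measure cover the space. *)
Lemma condexp_defined_local (f : T -> R[i]) : complex_measurable f ->
  (forall B, A B -> (mu B < +oo)%E ->
    condexp_defined mu A (fun x => f x * (\1_B x)%:C)) ->
  condexp_defined mu A f.
Proof.
move=> mf floc; have [F FT AF] := hfin.
have mc := cmod_measurable mf.
have finF i : {ae mu, forall x, F i x ->
    (condexp_ge0 mu A (EFin \o (fun y => cmod (f y))) x < +oo)%E}.
  have [AFi Fifin] := AF i.
  have : {ae mu, forall x, (condexp_ge0 mu A
      (EFin \o (\1_(F i) \* (fun y => cmod (f y)))%R) x =
      (\1_(F i) x)%:E * condexp_ge0 mu A (EFin \o (fun y => cmod (f y))) x)%E}.
    apply: condexp_ge0M => //; last by move=> x; exact: cmod_ge0.
    exact: indic_sub_measurable.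
  have := floc _ AFi Fifin; rewrite /condexp_defined.
  rewrite (_ : (fun y => _) = EFin \o (\1_(F i) \* (fun y => cmod (f y)))%R); last first.
    apply/funext => y /=; rewrite cmodM cmod_real mulrC ger0_norm//.
  move=> H1 H2; apply: filterS2 H1 H2 => x + + xFi; move=> /[swap] ->.
  by rewrite indicE mem_set// mul1e.
apply: filterS (ae_foralln finF) => x Fx.
have : (\bigcup_i F i) x by rewrite FT.
by move=> [i _ xFi]; exact: Fx xFi.
Qed.

(** This is the finite subset property of a sigma-finite measure. *)
Lemma sub_measure_gt0_fin (D : set T) : A D -> (0 < mu D)%E ->
  exists B, [/\ A B, B `<=` D, (0 < mu B)%E & (mu B < +oo)%E].
Proof.
move=> AD D0; have [F FT AF] := hfin.
have mF i : measurable (F i) by have [/hA.2] := AF i.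
have mD : measurable D by exact: hA.2.
have [[i Fi0]|noF] := pselect (exists i, (0 < mu (D `&` F i))%E).
  exists (D `&` F i); split => //.
  - apply/(sub_measurableE hA); apply: measurableI; apply/(sub_measurableE hA) => //.
    by have [] := AF i.
  - by have [_] := AF i; apply: le_lt_trans; apply: le_measure; rewrite ?inE//;
      exact: measurableI.
suff : mu.-negligible D by move/measure_negligible => /(_ mD) D00; rewrite D00 ltxx in D0.
rewrite -(setIT D) -FT setI_bigcupr; apply: negligible_bigcup => i.
apply/negligibleP; first exact: measurableI.
apply/eqP; rewrite eq_le measure_ge0 andbT leNgt.
by apply/negP => Fi0; apply: noF; exists i.
Qed.

End CondIntegrable.

(** * The spectrum of the weighted conditional expectation *)

Section Spectrum.
Context {d : measure_display} {T : measurableType d} {R : realType}.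
Variables (mu : {measure set T -> \bar R}) (A : set (set T)).
Hypothesis hA : sub_sigma_algebra_of A.
Hypothesis hfin : sub_sigma_finite mu A.
Variable Phi : R -> R.
Hypothesis hPhi : young_function Phi.
Variable u : T -> R[i].
Hypothesis hu : complex_measurable u.
Hypothesis hT : condexp_mul_bounded mu A Phi u.
Local Notation TA := (g_sigma_algebraType A).
Local Notation Eu := (condexp mu A u).
Local Notation Tu := (condexp_mul mu A u).
Local Notation N := (luxemburg_norm mu Phi).

Lemma condexp_linear (a b f g : T -> R[i]) :
  sub_complex_measurable A a -> sub_complex_measurable A b ->
  cond_integrable mu A f -> cond_integrable mu A g ->
  ae_eq mu setT (condexp mu A (fun x => a x * f x + b x * g x))
    (fun x => a x * condexp mu A f x + b x * condexp mu A g x).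
Proof.
move=> ma mb cf cg.
have [caf afE] := condexpM hA hfin ma cf.
have [cbg bgE] := condexpM hA hfin mb cg.
have [_ sE] := condexpD hA hfin caf cbg.
by apply: filterS3 afE bgE sE => x afx bgx sx _; rewrite sx// afx// bgx.
Qed.

Lemma cond_integrable_mul f : orlicz mu Phi f ->
  cond_integrable mu A (fun x => u x * f x).
Proof.
move=> orf; apply: condexp_defined_cond_integrable => //.
  by apply: complex_measurableM => //; case: orf.
exact: hT.1.
Qed.

(** The constant function [1] need not be in the Orlicz space, but the indicators
    of sets of finite measure are, and [T] is defined at them. *)
Lemma cond_integrable_symbol : cond_integrable mu A u.
Proof.
apply: condexp_defined_cond_integrable => //.
apply: condexp_defined_local => // B AB Bfin.
by apply: hT.1; apply: orlicz_indic => //; exact: hA.2.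
Qed.

Lemma sub_complex_measurable_cst (l : R[i]) : sub_complex_measurable A (cst l).
Proof. exact: complex_measurable_cst. Qed.

Lemma condexp_mul_measurable f : sub_complex_measurable A (Tu f).
Proof. exact: condexp_measurable. Qed.

(** Since [w T f] is measurable for [A], it comes out of the expectation and
    leaves [E(u)] behind.  Both identities that make the resolvent a two-sided
    inverse are instances: [w = 1] with [c = - l], and [w = 1 / (E(u) - l)] with
    [c = - 1]. *)
Lemma condexp_mul_affine (w f : T -> R[i]) : sub_complex_measurable A w ->
  orlicz mu Phi (fun x => Tu f x * w x) -> orlicz mu Phi f ->
  forall c : R[i],
  ae_eq mu setT (Tu (fun x => Tu f x * w x + c * f x))
    (fun x => Tu f x * w x * Eu x + c * Tu f x).
Proof.
move=> mw oTw orf c; rewrite /condexp_mul.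
rewrite (_ : (fun x => u x * _) =
  (fun x => (Tu f x * w x) * u x + (cst c) x * (u x * f x))); last first.
  by apply/funext => x /=; rewrite mulrDr mulrC mulrCA.
apply: condexp_linear.
- exact: (complex_measurableM (condexp_mul_measurable f) mw).
- exact: sub_complex_measurable_cst.
- exact: cond_integrable_symbol.
- exact: cond_integrable_mul.
Qed.

(** If every [S] intersected with [F i] were a.e. equal to a member [B i] of [A],
    then [S] would be a.e. equal to the union of the [B i]. *)
Lemma proper_mod_null_fin : proper_mod_null mu A ->
  exists S, [/\ measurable S, (mu S < +oo)%E &
    forall B, A B -> mu (S `+` B) != 0%E].
Proof.
move=> [S mS SB]; have [F FT AF] := hfin.
have mF i : measurable (F i) by have [/hA.2] := AF i.
have [[i iP]|noi] := pselect (exists i, forall B, A B -> mu ((S `&` F i) `+` B) != 0%E).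
  exists (S `&` F i); split => //; first exact: measurableI.
  by have [_] := AF i; apply: le_lt_trans; apply: le_measure; rewrite ?inE//;
      exact: measurableI.
have /choice[B BP] i : exists B, A B /\ mu ((S `&` F i) `+` B) = 0%E.
  apply: contrapT => noB; apply: noi; exists i => B AB.
  by apply/negP => /eqP B0; apply: noB; exists B.
have AUB : A (\bigcup_i B i).
  apply/(sub_measurableE hA); apply: bigcup_measurable => i _.
  by apply/(sub_measurableE hA); have [] := BP i.
have := SB _ AUB.
suff -> : mu (S `+` \bigcup_i B i) = 0%E by rewrite eqxx.
have mSB (C D : set T) : measurable C -> measurable D -> measurable (C `+` D).
  by move=> mC mD; apply: measurableU; exact: measurableD.
apply: measure_negligible; first by apply: mSB => //; exact: hA.2.
have : mu.-negligible (\bigcup_i ((S `&` F i) `+` B i)).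
  apply: negligible_bigcup => i; have [ABi Bi0] := BP i.
  apply/negligibleP => //; apply: mSB; first exact: measurableI.
  exact: hA.2.
apply: negligibleS => x [[Sx nBx]|[[i _ Bix] nSx]].
  have : (\bigcup_i F i) x by rewrite FT.
  move=> [i _ xFi]; exists i => //; left; split => // Bix.
  by apply: nBx; exists i.
by exists i => //; right; split => // -[].
Qed.

(** The value of [T] at the preimage of [1_S] would be measurable for [A] and
    a.e. equal to [1_S]; the set where its real part is [1] would then be a
    member of [A] that agrees a.e. with [S]. *)
Lemma zero_in_spectrum : proper_mod_null mu A -> orlicz_spectrum mu Phi Tu 0.
Proof.
move=> /proper_mod_null_fin[S [mS Sfin SB]] [V [Vlin Vbd Vinv]].
pose f x : R[i] := (\1_S x)%:C.
have [_ fE] := Vinv f (orlicz_indic hPhi mS Sfin).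
pose B := (fun x => complex.Re (Tu (V f) x)) @^-1` [set 1].
have AB : A B.
  apply/(sub_measurableE hA); rewrite -[X in measurable X]setTI.
  by apply: (condexp_mul_measurable (V f)).1.
have /negP := SB _ AB; apply; apply/eqP.
apply: measure_negligible.
  by apply: measurableU; apply: measurableD => //; exact: hA.2.
apply: negligibleS fE => x SBx /= /(_ I); rewrite mul0r subr0 => Tx.
have BS : B x <-> S x.
  rewrite /B /preimage /mkset Tx /f /= indicE; split; last by move=> Sx; rewrite mem_set.
  case: (asboolP (S x)) => // nSx; rewrite memNset// => /eqP.
  by rewrite eq_sym oner_eq0.
by case: SBx => -[] /BS.
Qed.

Lemma condexp_sub_measurable_set (l : R[i]) (e : R) :
  A [set x | cmod (Eu x - l) < e].
Proof.
apply/(sub_measurableE hA); rewrite -[X in measurable X]setTI.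
have mE : complex_measurable (fun x : TA => Eu x - l).
  apply: (complex_measurableD (condexp_measurable mu hA u)).
  exact: (sub_complex_measurable_cst (- l)).
have mc : measurable_fun (setT : set TA) (fun x : TA => (cmod (Eu x - l))%:E).
  by apply/measurable_EFinP; exact: cmod_measurable mE.
exact: (emeasurable_fun_infty_o measurableT mc e%:E).
Qed.

(** With a bounded inverse of norm at most [M], the functions [1_B] would satisfy
    [N(1_B) <= |M| e N(1_B)] with [0 < N(1_B)]; the choice of [e] makes
    [|M| e < 1]. *)
Lemma ess_range_spectrum (l : R[i]) :
  ess_range mu Eu l -> orlicz_spectrum mu Phi Tu l.
Proof.
move=> hl [V [_ [Vorl [M VM]] Vinv]].
pose e : R := (2 * (`|M| + 1))^-1.
have M1 : 0 < `|M| + 1 by rewrite ltr_wpDl.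
have e0 : 0 < e by rewrite invr_gt0 mulr_gt0.
have [B [AB BD B0 Bfin]] :=
  sub_measure_gt0_fin hA hfin (condexp_sub_measurable_set l e) (hl e e0).
have mB : measurable B by exact: hA.2.
pose f x : R[i] := (\1_B x)%:C.
have orf : orlicz mu Phi f by exact: orlicz_indic.
have Nf0 : 0 < N f by exact: luxemburg_indic_gt0.
have mf : sub_complex_measurable A f.
  by apply: complex_measurable_real; exact: indic_sub_measurable.
pose F x := Tu f x - l * f x.
have TfE : ae_eq mu setT (Tu f) (fun x => f x * Eu x).
  rewrite /condexp_mul (_ : (fun x => u x * f x) = (fun x => f x * u x)).
    by have [] := condexpM hA hfin mf cond_integrable_symbol.
  by apply/funext => x; rewrite mulrC.
have Ff : {ae mu, forall x, cmod (F x) <= e * cmod (f x)}.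
  apply: filterS TfE => x Tx; rewrite /F Tx// mulrC -mulrBl cmodM.
  rewrite /f cmod_real indicE; case: (asboolP (B x)) => Bx.
    by rewrite mem_set// normr1 !mulr1 ltW//; exact: BD.
  by rewrite memNset// normr0 !mulr0.
have mF : complex_measurable F.
  apply: (complex_measurableD (f := Tu f) (g := fun x => - (l * f x))).
    exact: (sub_complex_measurableW hA (condexp_mul_measurable f)).
  rewrite (_ : (fun x => _) = (fun x => (cst (- l)) x * f x)).
    apply: complex_measurableM; first exact: complex_measurable_cst.
    by case: orf.
  by apply/funext => x; rewrite mulNr.
have [oF NF] := orlicz_le hPhi mF orf e0 Ff.
have oV := Vorl F oF; have [VF _] := Vinv f orf.
have fV : {ae mu, forall x, cmod (f x) <= 1 * cmod (V F x)}.
  by apply: filterS VF => x /(_ I) ->; rewrite mul1r.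
have [_ NV] := orlicz_le hPhi orf.1 oV ltr01 fV.
have : N f <= `|M| * (e * N f).
  rewrite mul1r in NV; apply: (le_trans NV); apply: (le_trans (VM F oF)).
  apply: (@le_trans _ _ (`|M| * N F)).
    by rewrite ler_wpM2r ?luxemburg_norm_ge0// ler_norm.
  by rewrite ler_wpM2l.
rewrite mulrA -[leLHS]mul1r ler_pM2r// /e ler_pdivlMr ?mulr_gt0//.
by rewrite mul1r mulrDr mulr1; move: (`|M|) (normr_ge0 M) => m; lra.
Qed.

(** The candidate is [V f = (T f * w - f) / l] with [w = 1 / (E(u) - l)], found by
    solving [(T - l) g = f] first for [T g].  Its norm is at most
    [(e^-1 M + 1) / |l|] when [M] bounds that of [T]. *)
Lemma resolvent_exists (l : R[i]) (e : R) : l != 0 -> 0 < e ->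
  {ae mu, forall x, e <= cmod (Eu x - l)} ->
  exists V : (T -> R[i]) -> T -> R[i],
    [/\ orlicz_linear mu Phi V, orlicz_bounded mu Phi V &
      forall f, orlicz mu Phi f ->
        ae_eq mu setT (V (fun x => Tu f x - l * f x)) f /\
        ae_eq mu setT (fun x => Tu (V f) x - l * V f x) f].
Proof.
move=> l0 e0 Ee.
have [Torl [M TM]] := hT.2.
pose w x := (Eu x - l)^-1.
have mw : sub_complex_measurable A w.
  apply: (@complex_measurableV _ TA).
  apply: (@complex_measurableD _ TA _ _ (cst (- l))).
    exact: condexp_measurable.
  exact: complex_measurable_cst.
have mw' := sub_complex_measurableW hA mw.
have wE : {ae mu, forall x, (Eu x - l) * w x = 1}.
  apply: filterS Ee => x ex; rewrite divff//.
  by apply/eqP => E0; move: ex; rewrite E0 cmod0 leNgt e0.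
have we : {ae mu, forall x, cmod (w x) <= e^-1}.
  apply: filterS Ee => x ex; rewrite /w cmodV lef_pV2// posrE.
  exact: lt_le_trans ex.
have mT f := sub_complex_measurableW hA (condexp_mul_measurable f).
have oTw f : orlicz mu Phi f -> orlicz mu Phi (fun x => Tu f x * w x) /\
    N (fun x => Tu f x * w x) <= e^-1 * N (Tu f).
  move=> orf; apply: (orlicz_le hPhi _ (Torl f orf)).
  - exact: complex_measurableM.
  - by rewrite invr_gt0.
  - apply: filterS we => x wx; rewrite cmodM mulrC.
    by rewrite ler_wpM2r// cmod_ge0.
have oZ c f : c != 0 -> orlicz mu Phi f -> orlicz mu Phi (fun x => c * f x) /\
    N (fun x => c * f x) <= cmod c * N f.
  move=> c0 orf; apply: (orlicz_le hPhi _ orf).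
  - apply: (complex_measurableM (f := cst c)); last by case: orf.
    exact: complex_measurable_cst.
  - exact: cmod_gt0.
  - by apply: aeW => x; rewrite cmodM.
have N10 : (-1 : R[i]) != 0 by rewrite oppr_eq0 oner_eq0.
have lV0 : l^-1 != 0 by rewrite invr_eq0.
pose V f x := l^-1 * (Tu f x * w x + -1 * f x).
have oS f (orf : orlicz mu Phi f) := orliczD hPhi (oTw f orf).1 (oZ _ f N10 orf).1.
have oV f (orf : orlicz mu Phi f) := oZ _ _ lV0 (oS f orf).1.
exists V; split.
- split.
  + move=> f g orf og fg.
    have TE : Tu f = Tu g.
      apply: condexp_ext => //.
      * by apply: complex_measurableM => //; case: orf.
      * by apply: complex_measurableM => //; case: og.
      * by apply: filterS fg => x fgx _; rewrite fgx.
    by apply: filterS fg => x fgx _; rewrite /V TE fgx.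
  + move=> a f g orf og.
    have TE : ae_eq mu setT (Tu (fun x => a * f x + g x))
        (fun x => a * Tu f x + 1 * Tu g x).
      rewrite /condexp_mul (_ : (fun x => u x * _) =
        (fun x => (cst a) x * (u x * f x) + (cst 1) x * (u x * g x))).
        apply: (@condexp_linear (cst a) (cst 1) (fun x => u x * f x)
          (fun x => u x * g x)).
        - exact: sub_complex_measurable_cst.
        - exact: sub_complex_measurable_cst.
        - exact: cond_integrable_mul.
        - exact: cond_integrable_mul.
      by apply/funext => x /=; rewrite mul1r mulrDr mulrCA.
    apply: filterS TE => x Tx _; rewrite /V Tx//.
    by move: (Tu f x) (Tu g x) (w x) (f x) (g x) => p q r s t; ring.
- split; first by move=> f /oV[].
  exists (cmod l^-1 * (e^-1 * M + 1)) => f orf.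
  apply: (le_trans (oV f orf).2); rewrite -mulrA ler_wpM2l ?cmod_ge0//.
  apply: (le_trans (oS f orf).2); rewrite mulrDl mul1r lerD//.
    apply: (le_trans (oTw f orf).2); rewrite -mulrA ler_wpM2l//.
      by rewrite invr_ge0 ltW.
    exact: TM.
  by have [_] := oZ _ f N10 orf; rewrite cmodN cmodE Normc.normc1 mul1r.
- move=> f orf; split.
  + have m1 : sub_complex_measurable A (cst (1 : R[i])).
      exact: (sub_complex_measurable_cst 1).
    have H : ae_eq mu setT (Tu (fun x => Tu f x * (cst 1) x + (- l) * f x))
        (fun x => Tu f x * (cst 1) x * Eu x + - l * Tu f x).
      apply: condexp_mul_affine => //.
      rewrite (_ : (fun x => _) = Tu f); first exact: Torl.
      by apply/funext => x; rewrite mulr1.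
    have fE : (fun x => Tu f x - l * f x) = (fun x => Tu f x * (cst 1) x + (- l) * f x).
      by apply/funext => x /=; rewrite mulr1 mulNr.
    apply: filterS2 wE H => x wx Tx _; rewrite /V fE Tx// /= mulr1.
    have -> : Tu f x * Eu x + - l * Tu f x = Tu f x * (Eu x - l) by ring.
    by rewrite -mulrA wx; field.
  + have H := condexp_mul_affine mw (oTw f orf).1 orf (-1).
    have H2 : ae_eq mu setT (Tu (V f))
        (fun x => l^-1 * Tu (fun x => Tu f x * w x + -1 * f x) x).
      rewrite /condexp_mul /V (_ : (fun x => u x * _) = (fun x => (cst l^-1) x *
        (u x * (Tu f x * w x + -1 * f x)))).
        have [] := condexpM hA hfin (sub_complex_measurable_cst l^-1)
          (cond_integrable_mul (oS f orf).1).
        by [].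
      by apply/funext => x /=; rewrite mulrCA.
    apply: filterS3 wE H H2 => x wx Hx H2x _; rewrite H2x// Hx// /V.
    have wEu : w x * Eu x = 1 + l * w x by rewrite -wx; ring.
    by rewrite -mulrA wEu; field.
Qed.

End Spectrum.

Theorem theorem2p5 (d : measure_display) (T : measurableType d) (R : realType)
    (mu : {measure set T -> \bar R}) (A : set (set T))
    (hA : sub_sigma_algebra_of A) (hfin : sub_sigma_finite mu A)
    (Phi : R -> R) (hPhi : young_function Phi)
    (u : T -> R[i]) (hu : complex_measurable u)
    (hT : condexp_mul_bounded mu A Phi u)
    (hAS : proper_mod_null mu A) :
  orlicz_spectrum mu Phi (condexp_mul mu A u) =
  ess_range mu (condexp mu A u) `|` [set 0].
Proof.
apply/seteqP; split => l; last first.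
  move=> [/(ess_range_spectrum hA hfin hPhi hu hT)//|->].
  exact: (@zero_in_spectrum _ _ _ mu A hA hfin Phi hPhi u hAS).
move=> noV; have [->|l0] := eqVneq l 0; first by right.
left => e e0; rewrite lt_neqAle measure_ge0 andbT eq_sym.
apply/negP => /eqP D0; apply: noV.
apply: (resolvent_exists hA hfin hPhi hu hT l0 e0).
exists [set x | cmod (condexp mu A u x - l) < e]; split => //.
  by apply: hA.2; exact: condexp_sub_measurable_set.
by move=> x /= /negP; rewrite -ltNge.
Qed.
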